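(* Let a combined non-degenerate finitely additive Markov chain with Markov operator $A$ be given on an arbitrary discrete space $(X,\Sigma_d)$, and let $\mu=A\mu\in S_{ba}$ be an invariant finitely additive probability measure. Let $\mu=\mu_{ca}+\mu_{pfa}$ be its decomposition into the countably additive component $\mu_{ca}$ and the purely finitely additive component $\mu_{pfa}$, and suppose $\mu_{ca}\neq0$ and $\mu_{pfa}\neq0$. Then the measures $\mu_{ca}$ and $\mu_{pfa}$ are not invariant for the operator $A$, that is, $\mu_{ca}\neq A\mu_{ca}$ and $\mu_{pfa}\neq A\mu_{pfa}$.
   Context: ''Arbitrary discrete space'' $(X,\Sigma_d)$: $X$ is an infinite set, $\Sigma_d=2^X$ is the sigma-algebra of all subsets of $X$, and the cardinality of $X$ is ''immeasurable'', meaning that every finite countably additive measure on $2^X$ that is zero on every one-point set is identically zero. $B(X,\Sigma_d)$ is the space of bounded $\Sigma_d$-measurable functions $X\to\mathbb R$. $ba(X,\Sigma_d)$ and $ca(X,\Sigma_d)$ are the spaces of bounded real-valued finitely additive, respectively countably additive, measures on $\Sigma_d$. A finitely additive measure $\mu\ge0$ is purely finitely additive if every countably additive measure $\lambda$ with $0\le\lambda\le\mu$ is identically zero; a signed measure is purely finitely additive if both components of its Jordan decomposition are. $pfa(X,\Sigma_d)$ is the space of bounded purely finitely additive measures. Every $\mu\in ba(X,\Sigma_d)$ decomposes uniquely as $\mu=\mu_{ca}+\mu_{pfa}$ with $\mu_{ca}\in ca$, $\mu_{pfa}\in pfa$ (Alexandroff–Yosida–Hewitt decomposition). $S_{ba}$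 is the set of nonnegative $\mu\in ba(X,\Sigma_d)$ with $\mu(X)=1$. A finitely additive Markov chain is given by a finitely additive Markov kernel (transition function): a function $P(x,E)$, $x\in X$, $E\in\Sigma_d$, with $0\le P(x,E)\le1$, $P(\cdot,E)\in B(X,\Sigma_d)$ for all $E$, $P(x,\cdot)\in ba(X,\Sigma_d)$ and $P(x,X)=1$ for all $x$. Its Markov operator is $A:ba(X,\Sigma_d)\to ba(X,\Sigma_d)$, $A\mu(E)=\int_X P(x,E)\,\mu(dx)$ (Radon integral: the sup-norm continuous extension of the integral of simple functions). The kernel decomposes uniquely as $P(x,E)=P_{ca}(x,E)+P_{pfa}(x,E)$ with $P_{ca}(x,\cdot)\in ca(X,\Sigma_d)$, $P_{pfa}(x,\cdot)\in pfa(X,\Sigma_d)$ for all $x$. The chain is called combined if there are constants $0\le q_1,q_2\le1$, $q_1+q_2=1$, with $P_{ca}(x,X)=q_1$ and $P_{pfa}(x,X)=q_2$ for all $x\in X$; it is called non-degenerate if $0<q_1,q_2<1$. *)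

(* Defs.v *)
From HB Require Import structures.
From mathcomp Require Import all_boot all_order all_algebra.
From mathcomp Require Import all_classical all_reals all_analysis.

Set Implicit Arguments.
Unset Strict Implicit.
Unset Printing Implicit Defensive.

Import Order.TTheory GRing.Theory Num.Theory.
Import numFieldNormedType.Exports.

Local Open Scope classical_set_scope.
Local Open Scope ring_scope.

Section discrete_space.
Context {R : realType} {X : choiceType}.
Implicit Types (mu nu : set X -> R) (f s : X -> R).

(* The sigma-algebra is the full powerset: a measure is a function on [set X]
   and no measurability side condition is needed. *)

Definition finitely_additive mu : Prop :=
  forall E F, E `&` F = set0 -> mu (E `|` F) = mu E + mu F.

Definition countably_additive mu : Prop :=
  forall F : (set X)^nat, trivIset setT F ->
    (\sum_(0 <= i < n) mu (F i)) @[n --> \oo] --> mu (\bigcup_n F n).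

Definition ba mu : Prop := finitely_additive mu /\ bounded_fun mu.

Definition ca mu : Prop := ba mu /\ countably_additive mu.

Definition nonneg mu : Prop := forall E, 0 <= mu E.

Definition Sba mu : Prop := [/\ ba mu, nonneg mu & mu setT = 1].

(* The standard formulas for the Jordan components of a bounded finitely
   additive measure; no Hahn decomposition of the space is required. *)
Definition jordan_plus mu : set X -> R :=
  fun E => sup [set mu F | F in [set F | F `<=` E]].

Definition jordan_minus mu : set X -> R :=
  fun E => sup [set - mu F | F in [set F | F `<=` E]].

Definition nonneg_pfa mu : Prop :=
  [/\ ba mu, nonneg mu &
    forall lambda, ca lambda -> (forall E, 0 <= lambda E <= mu E) ->
      lambda = cst 0].

Definition pfa mu : Prop :=
  [/\ ba mu, nonneg_pfa (jordan_plus mu) & nonneg_pfa (jordan_minus mu)].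

(* ayh: Alexandroff-Yosida-Hewitt *)
Definition ayh_decomposition mu mu_ca mu_pfa : Prop :=
  [/\ ca mu_ca, pfa mu_pfa & forall E, mu E = mu_ca E + mu_pfa E].

(* Every function is measurable, so simple functions are those of finite
   range, and B(X) consists of all the bounded functions. *)
Definition simple f : Prop := finite_set (range f).

Definition B f : Prop := bounded_fun f.

Definition simple_integral mu s : R :=
  \sum_(y \in range s) y * mu (s @^-1` [set y]).

(* The extension by continuity, for the sup-norm, of [simple_integral mu] from
   the simple functions to their closure B(X): the limit of
   [simple_integral mu s] as [s] tends uniformly to [f] through the simple
   functions. It is meaningful for [ba mu] and [B f]. *)
Definition radon_integral mu f : R :=
  lim (simple_integral mu @
         within simple (nbhs (f : {uniform X -> R}))).

Definition markov_kernel (P : X -> set X -> R) : Prop :=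
  [/\ forall x E, 0 <= P x E <= 1,
      forall E, B (P ^~ E),
      forall x, ba (P x) &
      forall x, P x setT = 1].

Definition markov_operator (P : X -> set X -> R) mu : set X -> R :=
  fun E => radon_integral mu (P ^~ E).

Definition kernel_decomposition (P Pca Ppfa : X -> set X -> R) : Prop :=
  forall x, ayh_decomposition (P x) (Pca x) (Ppfa x).

Definition combined_with (P : X -> set X -> R) (q1 q2 : R) : Prop :=
  [/\ 0 <= q1 <= 1, 0 <= q2 <= 1, q1 + q2 = 1 &
    exists Pca Ppfa, [/\ kernel_decomposition P Pca Ppfa,
      forall x, Pca x setT = q1 & forall x, Ppfa x setT = q2]].

Definition combined_nondegenerate (P : X -> set X -> R) : Prop :=
  exists q1 q2, [/\ combined_with P q1 q2, 0 < q1 < 1 & 0 < q2 < 1].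

End discrete_space.

(* By Jordan decomposition, restricting to nonnegative measures here is
   equivalent to quantifying over all signed ones. *)
Definition immeasurable (R : realType) (X : choiceType) : Prop :=
  forall mu : set X -> R, ca mu -> nonneg mu ->
    (forall x, mu [set x] = 0) -> mu = cst 0.

Definition arbitrary_discrete_space (R : realType) (X : choiceType) : Prop :=
  infinite_set [set: X] /\ immeasurable R X.

(* Main.v *)
Require Import Defs.
From mathcomp Require Import all_boot all_order all_algebra.
From mathcomp Require Import all_classical all_reals all_analysis.
From mathcomp Require Import lra.

Set Implicit Arguments.
Unset Strict Implicit.
Unset Printing Implicit Defensive.

Import Order.TTheory GRing.Theory Num.Theory.
Import numFieldNormedType.Exports.

Local Open Scope classical_set_scope.
Local Open Scope ring_scope.

(** The countably additive part of an invariant measure cannot be invariant by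
    itself, because the operator leaks mass out of it towards purely finitely
    additive measures.

    Suppose that [nu] is countably additive, nonnegative, nonzero and
    [nu = A nu].  On a set of immeasurable cardinality [nu] cannot vanish on
    all the points, so some point [a] has mass [m > 0].  The operator [A] is
    positive, hence [m * P(a, E) <= A nu E = nu E] for every [E]
    ([markov_operator_point]).  A nonnegative additive measure dominated by a
    countably additive one is continuous from above at the empty set, hence
    countably additive ([ca_dominated]); so [P(a, .)] is countably additive.
    Then so is its purely finitely additive component, as the difference of
    two countably additive measures.  But a measure which is both countably
    and purely finitely additive has no positive mass ([pfa_ca_le0]), whereas
    that component has total mass [q2 > 0] ([kernel_not_ca]).  This is
    [ca_not_invariant].

    It applies to [mu_ca] once [mu_ca] is known to be nonnegative
    ([ayh_ca_ge0]).  The claim on [mu_pfa] follows by linearity: if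
    [A mu = mu] and [A mu_pfa = mu_pfa], then [A mu_ca = mu_ca].

    Two pieces of theory support this.  The first is that the Jordan
    components of a countably additive measure are countably additive
    ([ca_jordan_plus]); pure finite additivity of a signed measure is defined
    through its Jordan components, and only countably additive measures can be
    tested against them.  The second is that the integral of a bounded
    function, a limit along the simple functions that converge uniformly to
    it, exists for a nonnegative measure ([simple_integral_cvg]); it then
    inherits positivity and additivity in the measure from the integral of
    simple functions. *)

(** * Finitely and countably additive measures *)

Lemma bounded_fun_normP (R : realType) (T : Type) (f : T -> R) :
  bounded_fun f <-> exists M, forall x, `|f x| <= M.
Proof.
split=> [[M [_ hM]]|[M hM]].
  by exists (M + 1) => x; apply: (hM (M + 1)) => //; rewrite ltrDl.
exists M; split; first exact: num_real.
by move=> y /ltW My x _; apply: le_trans (hM x) My.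
Qed.

Section additive_measures.
Context {R : realType} {X : choiceType}.
Implicit Types (mu nu lambda : set X -> R) (E F : set X).

Lemma additive_set0 mu : finitely_additive mu -> mu set0 = 0.
Proof.
move=> /(_ set0 set0 (setI0 _)); rewrite setU0 => h.
by apply/eqP; rewrite -(subrr (mu set0)) {2}h addrK.
Qed.

Lemma additive_setD mu E F : finitely_additive mu -> E `<=` F ->
  mu (F `\` E) = mu F - mu E.
Proof.
by move=> amu EF; rewrite -{2}(setDUK EF) amu ?setDIK// addrAC subrr add0r.
Qed.

Lemma additive_le mu E F : finitely_additive mu -> nonneg mu -> E `<=` F ->
  mu E <= mu F.
Proof. by move=> amu mu0 EF; rewrite -subr_ge0 -additive_setD. Qed.

Lemma additive_bigcup mu (F : (set X)^nat) n : finitely_additive mu ->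
  trivIset setT F ->
  mu (\big[setU/set0]_(i < n) F i) = \sum_(0 <= i < n) mu (F i).
Proof.
move=> amu tF; elim: n => [|n IH].
  by rewrite big_ord0 big_geq// additive_set0.
rewrite big_ord_recr/= amu; first by rewrite IH big_nat_recr.
rewrite -bigcup_mkord setI_bigcupl -subset0 => x [i /= lin [Fi Fn]].
by move: lin; rewrite (tF i n I I (ex_intro _ x (conj Fi Fn))) ltnn.
Qed.

Lemma baN mu : ba mu -> ba (fun E => - mu E).
Proof.
move=> [amu /bounded_fun_normP [M hM]]; split.
  by move=> E F EF; rewrite amu// opprD.
by apply/bounded_fun_normP; exists M => E; rewrite normrN.
Qed.

Lemma caN mu : ca mu -> ca (fun E => - mu E).
Proof.
move=> [bmu cmu]; split; first exact: baN.
by move=> F tF; under eq_fun do rewrite sumrN; apply: cvgN; exact: cmu.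
Qed.

Lemma baD mu nu : ba mu -> ba nu -> ba (fun E => mu E + nu E).
Proof.
move=> [amu /bounded_fun_normP [M hM]] [anu /bounded_fun_normP [N hN]]; split.
  by move=> E F EF; rewrite amu// anu// addrACA.
apply/bounded_fun_normP; exists (M + N) => E.
by apply: le_trans (ler_normD _ _) _; exact: lerD.
Qed.

Lemma caD mu nu : ca mu -> ca nu -> ca (fun E => mu E + nu E).
Proof.
move=> [bmu cmu] [bnu cnu]; split; first exact: baD.
move=> F tF; under eq_fun do rewrite big_split/=.
by apply: cvgD; [exact: cmu|exact: cnu].
Qed.

Lemma caZ (c : R) mu : ca mu -> ca (fun E => c * mu E).
Proof.
move=> [[amu /bounded_fun_normP [M hM]] cmu]; split; first split.
- by move=> E F EF; rewrite amu// mulrDr.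
- apply/bounded_fun_normP; exists (`|c| * M) => E.
  by rewrite normrM ler_wpM2l.
- by move=> F tF; under eq_fun do rewrite -mulr_sumr; apply: cvgMr; exact: cmu.
Qed.

(** The tails of a disjoint union have small [lambda]-measure, hence small
    [nu]-measure: the defect of countable additivity of [nu] is squeezed
    between 0 and that of [lambda]. *)
Lemma ca_dominated nu lambda : ba nu -> nonneg nu -> ca lambda ->
  (forall E, nu E <= lambda E) -> ca nu.
Proof.
move=> bnu nu0 [[alambda _] clambda] le_nu; split=> // F tF.
have [anu _] := bnu.
set U := \bigcup_n F n.
have sU n : \big[setU/set0]_(i < n) F i `<=` U.
  by rewrite -bigcup_mkord => x [i _ Fix]; exists i.
set v := fun n => nu U - (lambda U - \sum_(0 <= i < n) lambda (F i)).
have vU : v @ \oo --> nu U.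
  have -> : nu U = nu U - (lambda U - lambda U) by rewrite subrr subr0.
  by apply: cvgB; [exact: cvg_cst|apply: cvgB; [exact: cvg_cst|exact: clambda]].
apply: (squeeze_cvgr _ vU (cvg_cst (nu U))).
apply: nearW => n; rewrite /v.
rewrite -(additive_bigcup n alambda tF) -(additive_bigcup n anu tF).
have := le_nu (U `\` \big[setU/set0]_(i < n) F i).
have := nu0 (U `\` \big[setU/set0]_(i < n) F i).
by rewrite (additive_setD anu (sU n)) (additive_setD alambda (sU n)); lra.
Qed.

(** * Jordan components *)

Lemma le_jordan_plus mu E F : ba mu -> F `<=` E -> mu F <= jordan_plus mu E.
Proof.
move=> [_ /bounded_fun_normP [M hM]] FE; apply: ub_le_sup; last by exists F.
by exists M => _ [G _ <-]; apply: le_trans (ler_norm _) (hM G).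
Qed.

Lemma jordan_plus_le mu E (c : R) : (forall F, F `<=` E -> mu F <= c) ->
  jordan_plus mu E <= c.
Proof.
move=> h; apply: ge_sup; first by exists (mu set0), set0.
by move=> _ [F FE <-]; exact: h.
Qed.

Lemma jordan_plus_ge0 mu : ba mu -> nonneg (jordan_plus mu).
Proof.
move=> bmu E; rewrite -(additive_set0 bmu.1); exact: le_jordan_plus.
Qed.

Lemma ba_jordan_plus mu : ba mu -> ba (jordan_plus mu).
Proof.
move=> bmu; have [amu /bounded_fun_normP [M hM]] := bmu; split.
  move=> E F EF; apply/eqP; rewrite eq_le; apply/andP; split.
    apply: jordan_plus_le => G GEF.
    have -> : G = (G `&` E) `|` (G `&` F) by rewrite -setIUr setIidl.
    rewrite amu; last by rewrite setIACA EF setI0.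
    by apply: lerD; apply: le_jordan_plus.
  rewrite -lerBrDr; apply: jordan_plus_le => G GE.
  rewrite lerBrDr addrC -lerBrDr; apply: jordan_plus_le => H HF.
  rewrite lerBrDr addrC -amu.
    by apply: le_jordan_plus => //; exact: setUSS.
  by apply/seteqP; split=> // x [/GE Ex /HF Fx]; rewrite -EF.
apply/bounded_fun_normP; exists M => E.
rewrite ger0_norm ?jordan_plus_ge0//; apply: jordan_plus_le => F _.
exact: le_trans (ler_norm _) (hM F).
Qed.

(** Only the bound by the sum of the series is at stake, the other one being
    finite additivity and monotonicity.  A subset [G] of the union is the
    disjoint union of the [G `&` F n], so that [mu G] is a limit of sums
    bounded termwise by those of the positive parts. *)
Lemma ca_jordan_plus mu : ca mu -> ca (jordan_plus mu).
Proof.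
move=> [bmu cmu]; have bj := ba_jordan_plus bmu; split=> // F tF.
have j0 := jordan_plus_ge0 bmu.
set U := \bigcup_n F n.
set u := fun n => \sum_(0 <= i < n) jordan_plus mu (F i).
have u_le n : u n <= jordan_plus mu U.
  rewrite /u -additive_bigcup//; last exact: bj.1.
  apply: additive_le => //; first exact: bj.1.
  by rewrite -bigcup_mkord => x [i _ Fix]; exists i.
have u_nd : {homo u : n m / (n <= m)%N >-> n <= m}.
  by apply/nondecreasing_seqP => n; rewrite /u big_nat_recr//= lerDl.
have u_ub : has_ubound (range u) by exists (jordan_plus mu U) => _ [n _ <-].
suff -> : jordan_plus mu U = sup (range u) by exact: nondecreasing_cvgn.
apply/eqP; rewrite eq_le; apply/andP; split; last first.
  by apply: ge_sup; [exists (u 0%N), 0%N|move=> _ [n _ <-]].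
apply: jordan_plus_le => G GU.
have GE : G = \bigcup_n (G `&` F n) by rewrite -setI_bigcupr setIidl.
have tG : trivIset setT (fun n => G `&` F n) by exact: trivIset_setIl.
rewrite GE; apply: (cvgr_to_le (cmu _ tG)).
apply: nearW => n; apply: le_trans (ub_le_sup u_ub (ex_intro2 _ _ n I erefl)).
by apply: ler_sum => i _; apply: le_jordan_plus.
Qed.

(** * Pure finite additivity *)

(** The positive part of such a measure is countably additive and dominated by
    itself, so it is zero. *)
Lemma pfa_ca_le0 mu E : ca mu -> pfa mu -> mu E <= 0.
Proof.
move=> cmu [bmu [_ _ jp] _].
have h : jordan_plus mu = cst 0.
  apply: jp; first exact: ca_jordan_plus.
  by move=> F; rewrite lexx andbT jordan_plus_ge0.
have -> : 0 = jordan_plus mu E by rewrite h.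
exact: le_jordan_plus.
Qed.

(** Where [mu_ca] is negative, [mu_pfa] must compensate, as their sum is
    nonnegative: the negative part of [mu_ca] is dominated by the positive
    part of [mu_pfa].  The former is countably additive, so it is zero. *)
Lemma ayh_ca_ge0 mu mu_ca mu_pfa : nonneg mu ->
  ayh_decomposition mu mu_ca mu_pfa -> nonneg mu_ca.
Proof.
move=> mu0 [cc [bp [_ _ jp] _] muE].
have h : jordan_minus mu_ca = cst 0.
  have cn := caN cc.
  apply: jp; first exact: (ca_jordan_plus cn).
  move=> E; rewrite (jordan_plus_ge0 cn.1 E)/=.
  apply: jordan_plus_le => F FE; apply: le_trans (le_jordan_plus bp FE).
  by have := mu0 F; rewrite muE; lra.
move=> E; rewrite -oppr_le0.
have -> : 0 = jordan_minus mu_ca E by rewrite h.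
exact: (@le_jordan_plus (fun E => - mu_ca E) _ _ (caN cc).1).
Qed.
End additive_measures.

(** * The integral of bounded functions *)

Section radon.
Context {R : realType} {X : choiceType}.
Implicit Types (mu : set X -> R) (f s t : X -> R).

Lemma additive_preimage (T : choiceType) mu (h : X -> T) (A : set T) :
  finitely_additive mu -> finite_set A ->
  mu (h @^-1` A) = \sum_(p \in A) mu (h @^-1` [set p]).
Proof.
move=> amu fA; rewrite fsbig_finite//=.
have {1}-> : A = [set` finmap.enum_fset (fset_set A)].
  by rewrite -{1}(fset_setK fA).
move: (finmap.fset_uniq (fset_set A)); elim: (finmap.enum_fset _) => [_|p r IH].
  rewrite big_nil (_ : _ @^-1` _ = set0) ?additive_set0//.
  by apply/seteqP; split.
move=> /= /andP[pr ur]; rewrite big_cons -IH//.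
rewrite -amu; last first.
  by apply/seteqP; split=> // x [/= ->]; rewrite (negbTE pr).
congr mu; apply/seteqP; split=> x /=; rewrite in_cons.
  by move=> /predU1P.
by move=> /predU1P.
Qed.

(** An integral may be computed on any finite partition on whose blocks the
    function is constant, here the fibres of [h].  Taking [h] to be a pair of
    simple functions gives a partition common to both. *)
Lemma simple_integral_comp (T : choiceType) mu (h : X -> T) (g : T -> R) :
  finitely_additive mu -> finite_set (range h) ->
  simple_integral mu (g \o h) =
    \sum_(p \in range h) g p * mu (h @^-1` [set p]).
Proof.
move=> amu fh.
have fgh : finite_set (range (g \o h)).
  by rewrite -(image_comp h g); exact: finite_image.
transitivity (\sum_(y \in range (g \o h)) \sum_(p \in range h)
    (if p \in g @^-1` [set y] then g p * mu (h @^-1` [set p]) else 0)).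
  apply: eq_fsbigr => y _; rewrite -fsbig_mkcondr.
  have -> : (g \o h) @^-1` [set y] = h @^-1` (range h `&` g @^-1` [set y]).
    by apply/seteqP; split=> x /=; [move=> <-; split=> //; exists x|case].
  have fI : finite_set (range h `&` g @^-1` [set y]) by exact: finite_setIl.
  rewrite additive_preimage// [LHS]fsbig_distrr//.
  by apply: eq_fsbigr => p; rewrite inE => -[_ /= ->].
rewrite exchange_fsbig//; apply: eq_fsbigr => p; rewrite inE => -[x _ hx].
rewrite -(@fsbig_widen _ _ _ _ [set g p]).
- by rewrite fsbig_set1 mem_set.
- by move=> _ ->; exists x; rewrite //= hx.
- by move=> y [_ /= yg]; rewrite memNset//= => gy; apply: yg; rewrite gy.
Qed.

(** Besides monotonicity ([d = 0]), this gives the Lipschitz bound in the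
    sup-norm on which the extension to bounded functions rests. *)
Lemma simple_integral_le mu s t (d : R) :
  finitely_additive mu -> nonneg mu -> simple s -> simple t ->
  (forall x, s x <= t x + d) ->
  simple_integral mu s <= simple_integral mu t + d * mu setT.
Proof.
move=> amu mu0 ss st st_le.
pose h x := (s x, t x).
have fh : finite_set (range h).
  by apply: (@finite_image11 _ _ _ _ setT (fun a b => (a, b)) s t).
rewrite -[s]/(fst \o h) -[t]/(snd \o h) !simple_integral_comp//.
have -> : mu setT = \sum_(p \in range h) mu (h @^-1` [set p]).
  rewrite -additive_preimage//; congr mu.
  by apply/seteqP; split=> // x _; exists x.
rewrite [X in _ <= _ + X]fsbig_distrr//= !fsbig_finite//= -big_split/= !big_seq.
apply: ler_sum => p; rewrite in_fset_set// inE => -[x _ <-].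
rewrite -mulrDl; apply: ler_wpM2r; [exact: mu0|exact: st_le].
Qed.

Lemma simple_integral_point mu (a : X) (c : R) : finitely_additive mu ->
  simple_integral mu (fun x => if x == a then c else 0) = c * mu [set a].
Proof.
move=> amu.
pose g (b : bool) := if b then c else 0.
rewrite -[X in simple_integral _ X]/(g \o eq_op^~ a).
rewrite simple_integral_comp//; last exact: finite_finset.
rewrite -(@fsbig_widen _ _ _ _ [set true]).
- rewrite fsbig_set1; congr (_ * mu _).
  by apply/seteqP; split=> x /=; [move/eqP|move=> ->; rewrite eqxx].
- by move=> _ ->; exists a => //=; rewrite eqxx.
- by move=> [] [_ /=]; rewrite ?mul0r// => /(_ erefl).
Qed.

Lemma simple_dense f (d : R) : B f -> 0 < d ->
  exists2 s, simple s & forall x, `|f x - s x| < d.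
Proof.
(* round [f] down to the grid [- M + d * nat], where [M] bounds [`|f|] *)
move=> /bounded_fun_normP [M hM] d0.
pose k x := Num.trunc ((f x + M) / d).
have fM0 x : 0 <= (f x + M) / d.
  by apply: divr_ge0; [have := hM x; rewrite ler_norml; lra|exact: ltW].
pose N := (Num.trunc ((M + M) / d)).+1.
exists (fun x => d * (k x)%:R - M).
  apply: (@sub_finite_set _ _ ((fun n : nat => d * n%:R - M) @` `I_N)).
    move=> _ [x _ <-]; exists (k x) => //=; rewrite /N ltnS.
    apply: le_truncn; rewrite ler_pM2r ?invr_gt0// lerD2r.
    by have := hM x; rewrite ler_norml; lra.
  by apply: finite_image; exact: finite_II.
move=> x; have /andP[] := truncn_itv (fM0 x).
rewrite -/(k x) ler_pdivlMr// ltr_pdivrMr// -natr1 => h1 h2.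
rewrite ltr_norml; apply/andP; split; lra.
Qed.

Lemma near_simpleP f (Q : set (X -> R)) :
  within simple (nbhs (f : {uniform X -> R})) Q <->
  exists2 d, 0 < d & forall s, simple s -> (forall x, `|f x - s x| < d) -> Q s.
Proof.
split.
  move=> /uniform_nbhs [E [+ EQ]]; rewrite -entourage_ballE => -[d /= d0 dE].
  by exists d => // s ss fs; apply: (EQ s) => // x _; apply: dE; exact: fs.
move=> [d d0 dQ]; apply/uniform_nbhs.
exists [set xy : R * R | ball xy.1 d xy.2]; split.
  by rewrite -entourage_ballE; exists d.
by move=> s fs ss; apply: dQ => // x; exact: fs.
Qed.

Lemma within_simple_proper f : B f ->
  ProperFilter (within simple (nbhs (f : {uniform X -> R}))).
Proof.
move=> Bf; split; last exact: within_filter.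
move=> /near_simpleP [d d0 h].
by have [s ss fs] := simple_dense Bf d0; exact: (h s).
Qed.

Lemma simple_integral_cvg mu f : finitely_additive mu -> nonneg mu -> B f ->
  simple_integral mu @ within simple (nbhs (f : {uniform X -> R})) -->
    radon_integral mu f.
Proof.
move=> amu mu0 Bf; have PF := within_simple_proper Bf.
apply: cauchy_cvg; apply: cauchy_exP => e e0.
(* the [+ 1] allows for [mu setT = 0]; the factor 1/2 is there because two
   simple functions that are [d]-close to [f] are only [2 * d]-close *)
have m1 : 0 < mu setT + 1 by rewrite ltr_wpDl.
have d0 : 0 < e / 2 / (mu setT + 1) by rewrite !divr_gt0.
set d := (e / 2 / (mu setT + 1)) in d0 *.
have de : 2 * d * mu setT < e.
  have : d * (mu setT + 1) = e / 2 by rewrite mulfVK// gt_eqF.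
  by rewrite mulrDr mulr1; lra.
have [s ss fs] := simple_dense Bf d0.
exists (simple_integral mu s).
apply/near_simpleP; exists d => // t st ft.
rewrite /ball/=.
have st_le x : s x <= t x + 2 * d.
  by have := fs x; have := ft x; rewrite !ltr_norml; lra.
have ts_le x : t x <= s x + 2 * d.
  by have := fs x; have := ft x; rewrite !ltr_norml; lra.
have := simple_integral_le amu mu0 ss st st_le.
have := simple_integral_le amu mu0 st ss ts_le.
by rewrite ltr_norml; lra.
Qed.

Lemma radon_integral_ge mu f s : finitely_additive mu -> nonneg mu -> B f ->
  simple s -> (forall x, s x <= f x) ->
  simple_integral mu s <= radon_integral mu f.
Proof.
move=> amu mu0 Bf ss sf; have PF := within_simple_proper Bf.
apply/ler_addgt0Pr => e e0.
have m1 : 0 < mu setT + 1 by rewrite ltr_wpDl.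
have d0 : 0 < e / (mu setT + 1) by rewrite divr_gt0.
set d := (e / (mu setT + 1)) in d0 *.
have de : d * mu setT <= e.
  have : d * (mu setT + 1) = e by rewrite mulfVK// gt_eqF.
  by rewrite mulrDr mulr1; lra.
rewrite -lerBlDr.
apply: (cvgr_to_ge (simple_integral_cvg amu mu0 Bf)).
apply/near_simpleP; exists d => // t st ft.
have := simple_integral_le amu mu0 ss st (d := d).
have h x : s x <= t x + d by have := sf x; have := ft x; rewrite ltr_norml; lra.
by move=> /(_ h); rewrite lerBlDr; lra.
Qed.

(** Stated as a difference so that [nu2] may be signed: the integral of a
    simple function is additive in the measure, so convergence for [nu2]
    follows from convergence for the nonnegative [mu] and [nu1]. *)
Lemma radon_integralB mu nu1 nu2 f :
  finitely_additive mu -> nonneg mu ->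
  finitely_additive nu1 -> nonneg nu1 ->
  (forall E, mu E = nu1 E + nu2 E) -> B f ->
  radon_integral nu2 f = radon_integral mu f - radon_integral nu1 f.
Proof.
move=> amu mu0 an n0 muE Bf; have PF := within_simple_proper Bf.
have cm := simple_integral_cvg amu mu0 Bf.
have cn := simple_integral_cvg an n0 Bf.
apply: cvg_lim => //; apply: cvg_trans (cvgB cm cn).
apply: near_eq_cvg; apply/near_simpleP; exists 1 => // s ss _ /=.
rewrite -[LHS]/(simple_integral mu s - simple_integral nu1 s).
rewrite /simple_integral !fsbig_finite//=.
by rewrite -sumrB; apply: eq_bigr => y _; rewrite muE; lra.
Qed.

(** The function [P ^~ E] is bounded below by the simple function equal to
    [P a E] at [a] and to 0 elsewhere. *)
Lemma markov_operator_point (P : X -> set X -> R) mu (a : X) (E : set X) :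
  markov_kernel P -> finitely_additive mu -> nonneg mu ->
  P a E * mu [set a] <= markov_operator P mu E.
Proof.
move=> [P01 BP _ _] amu mu0.
rewrite -simple_integral_point//; apply: radon_integral_ge => //.
  apply: (@sub_finite_set _ _ [set P a E; 0]); last exact: finite_set2.
  by move=> _ [x _ <-]; case: ifP => _; [left|right].
move=> x; case: eqP => [->//|_]; by have /andP[] := P01 x E.
Qed.
End radon.

(** * Invariant measures *)

Section invariant.
Context {R : realType} {X : choiceType}.

(** Otherwise [Ppfa a], the difference of [P a] and [Pca a], would be
    countably additive and would have total mass at most 0 rather than
    [q2 > 0]. *)
Lemma kernel_not_ca (P : X -> set X -> R) (a : X) :
  combined_nondegenerate P -> ~ ca (P a).
Proof.
move=> [q1 [q2 [[_ _ _ [Pca [Ppfa [dec _ hq2]]]] _ /andP[q20 _]]]] cPa.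
have [cPca pPpfa PE] := dec a.
have cPpfa : ca (Ppfa a).
  have -> : Ppfa a = fun E => P a E + - Pca a E.
    by apply/funext => E; rewrite PE addrAC subrr add0r.
  exact: caD cPa (caN cPca).
have := pfa_ca_le0 setT cPpfa pPpfa.
by rewrite hq2 leNgt q20.
Qed.

(** Invariance would make the rows of the kernel at the atoms of [nu]
    countably additive, as they are dominated by multiples of [nu]. *)
Lemma ca_not_invariant (P : X -> set X -> R) (nu : set X -> R) :
  immeasurable R X -> markov_kernel P -> combined_nondegenerate P ->
  ca nu -> nonneg nu -> nu <> cst 0 -> nu <> markov_operator P nu.
Proof.
move=> imX hP hPc cnu nu0 nuN0 nuA.
have [a nua] : exists a, nu [set a] != 0.
  apply: contrapT => h; apply: nuN0; apply: imX => // x.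
  by apply: contrapT => /eqP nux; apply: h; exists x.
have ma : 0 < nu [set a] by rewrite lt_def nua nu0.
have [P01 _ baP _] := hP.
apply: (kernel_not_ca (a := a) hPc).
apply: (@ca_dominated _ _ _ (fun E => (nu [set a])^-1 * nu E)).
- exact: baP.
- by move=> E; have /andP[] := P01 a E.
- exact: caZ.
- move=> E; rewrite mulrC ler_pdivlMr// [in leRHS]nuA.
  exact: (markov_operator_point a E hP cnu.1.1 nu0).
Qed.
End invariant.

Theorem theorem4p4 (R : realType) (X : choiceType)
    (hX : arbitrary_discrete_space R X)
    (P : X -> set X -> R) (hP : markov_kernel P)
    (hPc : combined_nondegenerate P)
    (mu : set X -> R) (hmu : Sba mu) (hinv : mu = markov_operator P mu)
    (mu_ca mu_pfa : set X -> R)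
    (hdec : ayh_decomposition mu mu_ca mu_pfa)
    (hca : mu_ca <> cst 0) (hpfa : mu_pfa <> cst 0) :
  mu_ca <> markov_operator P mu_ca /\ mu_pfa <> markov_operator P mu_pfa.
Proof.
have [[amu _] mu0 _] := hmu.
have ca0 := ayh_ca_ge0 mu0 hdec.
have [cca _ muE] := hdec.
have caN := ca_not_invariant hX.2 hP hPc cca ca0 hca.
split=> // pA; apply: caN; apply/funext => E.
have [_ BP _ _] := hP.
have := radon_integralB amu mu0 cca.1.1 ca0 muE (BP E).
rewrite -[LHS]/(markov_operator P mu_pfa E) -pA.
rewrite -[radon_integral mu _]/(markov_operator P mu E) -hinv.
rewrite -[radon_integral mu_ca _]/(markov_operator P mu_ca E) muE; lra.
Qed.
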